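(* There exists a fully faithful functor $F:\mathrm{PDynSys}_{\mathrm{Orb}}\to\mathrm{TopGrpd}$ that associates to a partial dynamical system $G\curvearrowright X$ its transformation groupoid $G\ltimes X$, and to an orbit morphism $(\phi,a)$ between $G\curvearrowright X$ and $H\curvearrowright Y$ the continuous homomorphism $\Theta_{(\phi,a)}:G\ltimes X\to H\ltimes Y$ given by $\Theta_{(\phi,a)}(g,x)=(a(g,x),\phi(x))$.
   Context: All groups are discrete and countable; the spaces acted upon are locally compact, Hausdorff and second-countable. A partial action of a group $G$ (identity $e_G$) on a space $X$ consists of open subsets $\{U_g\}_{g\in G}$ of $X$ and homeomorphisms $\varphi_g:U_{g^{-1}}\to U_g$, $x\mapsto g.x$, such that (i) $U_{e_G}=X$ and $\varphi_{e_G}=\mathrm{id}_X$; (ii) $g_2.(U_{(g_1g_2)^{-1}}\cap U_{g_2^{-1}})=U_{g_2}\cap U_{g_1^{-1}}$ for all $g_1,g_2\in G$, and $(g_1g_2).x=g_1.(g_2.x)$ for all $x\in U_{g_2^{-1}}\cap U_{(g_1g_2)^{-1}}$. The triple $(X,G,\varphi)$ is a partial dynamical system, written $G\curvearrowright X$. For a second system $H\curvearrowright Y$ the corresponding open sets are denoted $V_h$, $h\in H$. The transformation groupoid is $G\ltimes X=\{(g,x)\in G\times X: x\in U_{g^{-1}}\}$ with the subspace topology from $G\times X$, source $s(g,x)=x$, range $r(g,x)=g.x$, product $(g_1,g_2.x)(g_2,x)=(g_1g_2,x)$, inverse $(g,x)^{-1}=(g^{-1},g.x)$; its unit space is identified with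 $X$. An orbit morphism between $G\curvearrowright X$ and $H\curvearrowright Y$ is a pair $(\phi,a)$ of continuous functions $a:\bigcup_{g\in G}\{g\}\times U_{g^{-1}}\to H$ and $\phi:X\to Y$ such that: (1) $\phi(x)\in V_{a(g,x)^{-1}}$ and $\phi(g.x)=a(g,x).\phi(x)$ for all $g\in G$, $x\in U_{g^{-1}}$; (2) $a(g_1g_2,x)=a(g_1,g_2.x)\,a(g_2,x)$ for all $g_1,g_2\in G$ and $x\in U_{g_2^{-1}}\cap U_{(g_1g_2)^{-1}}$. The composition of $(\phi,a):G\curvearrowright X\to H\curvearrowright Y$ with $(\psi,b):H\curvearrowright Y\to K\curvearrowright Z$ is $(\psi,b)\circ(\phi,a)=(\psi\circ\phi,c)$ with $c(g,x)=b(a(g,x),\phi(x))$; the identity of $G\curvearrowright X$ is $(\mathrm{id}_X,i)$ with $i(g,x)=g$. $\mathrm{PDynSys}_{\mathrm{Orb}}$ is the category of partial dynamical systems and orbit morphisms. $\mathrm{TopGrpd}$ is the category of topological groupoids and continuous groupoid homomorphisms (continuous functors). *)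

(* Defs.v *)
From HB Require Import structures.
From mathcomp Require Import all_boot all_classical.
From mathcomp Require Import topology.

Set Implicit Arguments.
Unset Strict Implicit.
Unset Printing Implicit Defensive.

Local Open Scope classical_set_scope.
Local Open Scope group_scope.

Record category := Category {
  obj :> Type;
  hom : obj -> obj -> Type;
  cat_id : forall A, hom A A;
  cat_comp : forall A B C, hom B C -> hom A B -> hom A C;
  cat_idl : forall A B (f : hom A B), cat_comp (cat_id B) f = f;
  cat_idr : forall A B (f : hom A B), cat_comp f (cat_id A) = f;
  cat_compA : forall A B C D (f : hom C D) (g : hom B C) (h : hom A B),
    cat_comp f (cat_comp g h) = cat_comp (cat_comp f g) h
}.

Arguments cat_id {c} A.
Arguments cat_comp {c A B C}.

Record functor_laws (C D : category) (F0 : C -> D)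
    (F1 : forall A B : C, hom A B -> hom (F0 A) (F0 B)) : Prop := FunctorLaws {
  functor_id : forall A : C, F1 A A (cat_id A) = cat_id (F0 A);
  functor_comp : forall (A B E : C) (g : hom B E) (f : hom A B),
    F1 A E (cat_comp g f) = cat_comp (F1 B E g) (F1 A B f)
}.

Record functor (C D : category) := Functor {
  fobj :> C -> D;
  functor_map : forall A B : C, hom A B -> hom (fobj A) (fobj B);
  functor_mapP : functor_laws functor_map
}.

Arguments functor_map {C D} f {A B}.

Definition faithful (C D : category) (F : functor C D) : Prop :=
  forall A B : C, injective (functor_map F (A := A) (B := B)).

Definition full (C D : category) (F : functor C D) : Prop :=
  forall (A B : C) (g : hom (F A) (F B)),
    exists f : hom A B, functor_map F f = g.

Definition fully_faithful (C D : category) (F : functor C D) : Prop :=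
  full F /\ faithful F.

(* The product of g and h is only given for composable pairs (gh is defined   *)
(* when s(g) = r(h)); the laws quantify over proofs of composability, which   *)
(* exist by the source and range equations.                                   *)
Record topGroupoid := TopGroupoid {
  gunits : topologicalType;
  garr : topologicalType;
  gsrc : garr -> gunits;
  grng : garr -> gunits;
  gunit : gunits -> garr;
  ginv : garr -> garr;
  gmul : forall g h : garr, gsrc g = grng h -> garr;
  gsrc_unit : forall x, gsrc (gunit x) = x;
  grng_unit : forall x, grng (gunit x) = x;
  gsrc_mul : forall g h (e : gsrc g = grng h), gsrc (gmul e) = gsrc h;
  grng_mul : forall g h (e : gsrc g = grng h), grng (gmul e) = grng g;
  gsrc_inv : forall g, gsrc (ginv g) = grng g;
  grng_inv : forall g, grng (ginv g) = gsrc g;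
  gmulA : forall f g h (fg : gsrc f = grng g) (gh : gsrc g = grng h)
    (f_gh : gsrc f = grng (gmul gh)) (fg_h : gsrc (gmul fg) = grng h),
    gmul f_gh = gmul fg_h;
  gmul_unitl : forall g (e : gsrc (gunit (grng g)) = grng g), gmul e = g;
  gmul_unitr : forall g (e : gsrc g = grng (gunit (gsrc g))), gmul e = g;
  gmulV : forall g (e : gsrc g = grng (ginv g)), gmul e = gunit (grng g);
  gmulVl : forall g (e : gsrc (ginv g) = grng g), gmul e = gunit (gsrc g);
  gsrc_cont : continuous gsrc;
  grng_cont : continuous grng;
  gunit_cont : continuous gunit;
  ginv_cont : continuous ginv;
  gmul_cont : continuous
    (fun p : [set p : garr * garr | gsrc p.1 = grng p.2] =>
       gmul (set_mem (valP p)))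
}.

Arguments gsrc {t}.
Arguments grng {t}.
Arguments gunit {t}.
Arguments ginv {t}.
Arguments gmul {t g h}.

Record grpdHom (G H : topGroupoid) := GrpdHom {
  hunits : gunits G -> gunits H;
  harr :> garr G -> garr H;
  hunits_cont : continuous hunits;
  harr_cont : continuous harr;
  hsrc : forall g, gsrc (harr g) = hunits (gsrc g);
  hrng : forall g, grng (harr g) = hunits (grng g);
  hunit : forall x, harr (gunit x) = gunit (hunits x);
  hmul : forall g h (e : gsrc g = grng h) (e' : gsrc (harr g) = grng (harr h)),
    harr (gmul e) = gmul e'
}.

Lemma grpdHom_eq (G H : topGroupoid) (f f' : grpdHom G H) :
  hunits f = hunits f' -> harr f = harr f' -> f = f'.
Proof.
case: f f' => [u a ? ? ? ? ? ?] [u' a' ? ? ? ? ? ?] /= uu' aa'.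
by subst u' a'; congr GrpdHom; exact: Prop_irrelevance.
Qed.

Section TopGrpdCategory.
Variables G H K : topGroupoid.

Lemma idfun_cont (X : topologicalType) : continuous (@idfun X).
Proof. by move=> x; exact: cvg_id. Qed.

Lemma idfun_hmul (g h : garr G) (e : gsrc g = grng h)
  (e' : gsrc (idfun g) = grng (idfun h)) : idfun (gmul e) = gmul e'.
Proof. by congr gmul; exact: Prop_irrelevance. Qed.

Definition grpdHom_id : grpdHom G G := {|
  hunits := idfun;
  harr := idfun;
  hunits_cont := @idfun_cont (gunits G);
  harr_cont := @idfun_cont (garr G);
  hsrc := fun _ => erefl;
  hrng := fun _ => erefl;
  hunit := fun _ => erefl;
  hmul := idfun_hmul
|}.

Variables (f : grpdHom H K) (f' : grpdHom G H).

Lemma comp_hunits_cont : continuous (hunits f \o hunits f').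
Proof. by move=> x; apply: continuous_comp; exact: hunits_cont. Qed.

Lemma comp_harr_cont : continuous (harr f \o harr f').
Proof. by move=> x; apply: continuous_comp; exact: harr_cont. Qed.

Lemma comp_hsrc g :
  gsrc ((harr f \o harr f') g) = (hunits f \o hunits f') (gsrc g).
Proof. by rewrite /= !hsrc. Qed.

Lemma comp_hrng g :
  grng ((harr f \o harr f') g) = (hunits f \o hunits f') (grng g).
Proof. by rewrite /= !hrng. Qed.

Lemma comp_hunit x :
  (harr f \o harr f') (gunit x) = gunit ((hunits f \o hunits f') x).
Proof. by rewrite /= !hunit. Qed.

Lemma comp_hmul (g h : garr G) (e : gsrc g = grng h)
  (e' : gsrc ((harr f \o harr f') g) = grng ((harr f \o harr f') h)) :
  (harr f \o harr f') (gmul e) = gmul e'.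
Proof.
have e1 : gsrc (f' g) = grng (f' h) by rewrite hsrc hrng e.
by rewrite /= (hmul e e1) (hmul e1 e').
Qed.

Definition grpdHom_comp : grpdHom G K := {|
  hunits := hunits f \o hunits f';
  harr := harr f \o harr f';
  hunits_cont := comp_hunits_cont;
  harr_cont := comp_harr_cont;
  hsrc := comp_hsrc;
  hrng := comp_hrng;
  hunit := comp_hunit;
  hmul := comp_hmul
|}.

End TopGrpdCategory.

Lemma grpdHom_idl (G H : topGroupoid) (f : grpdHom G H) :
  grpdHom_comp (grpdHom_id H) f = f.
Proof. exact: grpdHom_eq. Qed.

Lemma grpdHom_idr (G H : topGroupoid) (f : grpdHom G H) :
  grpdHom_comp f (grpdHom_id G) = f.
Proof. exact: grpdHom_eq. Qed.

Lemma grpdHomA (G H K L : topGroupoid) (f : grpdHom K L) (g : grpdHom H K)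
  (h : grpdHom G H) :
  grpdHom_comp f (grpdHom_comp g h) = grpdHom_comp (grpdHom_comp f g) h.
Proof. exact: grpdHom_eq. Qed.

Definition TopGrpd : category := {|
  obj := topGroupoid;
  hom := grpdHom;
  cat_id := grpdHom_id;
  cat_comp := grpdHom_comp;
  cat_idl := grpdHom_idl;
  cat_idr := grpdHom_idr;
  cat_compA := grpdHomA
|}.

Definition homeomorphism (S T : topologicalType) (f : S -> T) : Prop :=
  continuous f /\
  exists f' : T -> S, [/\ cancel f f', cancel f' f & continuous f'].

Definition elt (T : Type) (A : set T) (x : T) (xA : x \in A) : A :=
  exist (fun y => y \in A) x xA.

(* [pdom g] is U_g, and [pact] at g maps U_(g^-1) to U_g. A set used          *)
(* as a type is the corresponding subtype, with the subspace topology. In     *)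
(* [pactM] the membership [g2x1] follows from [pact_img].                     *)
Record pDynSys := PDynSys {
  pgrp : groupType;
  psp : topologicalType;
  pgrp_countable : countable [set: pgrp];
  psp_locally_compact : locally_compact [set: psp];
  psp_hausdorff : hausdorff_space psp;
  psp_second_countable : @second_countable psp;
  pdom : pgrp -> set psp;
  pact : forall g, pdom g^-1 -> pdom g;
  pdom_open : forall g, open (pdom g);
  pact_homeo : forall g, homeomorphism (@pact g);
  pdom1 : pdom 1 = [set: psp];
  pact1 : forall x : pdom 1^-1, val (pact x) = val x;
  pact_img : forall g1 g2,
    [set val (pact x) | x in [set x : pdom g2^-1 | pdom (g1 * g2)^-1 (val x)]]
      = pdom g2 `&` pdom g1^-1;
  pactM : forall g1 g2 x (x2 : x \in pdom g2^-1) (x12 : x \in pdom (g1 * g2)^-1)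
    (g2x1 : val (pact (elt x2)) \in pdom g1^-1),
    val (pact (elt x12)) = val (pact (elt g2x1))
}.

Arguments pdom {p}.
Arguments pact {p g}.

Definition papp (S : pDynSys) (g : pgrp S) (x : psp S)
  (gx : x \in pdom g^-1) : psp S := val (pact (elt gx)).

(* The group is discrete, hence [discrete_topology]; [tdom S], as a type, is  *)
(* the arrow space of the transformation groupoid and the domain of cocycles. *)
Definition tdom (S : pDynSys) : set (discrete_topology (pgrp S) * psp S)%type :=
  [set p | pdom (p.1 : pgrp S)^-1 p.2].

Arguments tdom S : clear implicits.

Definition tgrp (S : pDynSys) (p : tdom S) : pgrp S := (val p).1.

Definition tsrc (S : pDynSys) (p : tdom S) : psp S := (val p).2.

Lemma tdomP (S : pDynSys) (p : tdom S) : tsrc p \in pdom (tgrp p)^-1.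
Proof. exact/mem_set/(set_mem (valP p)). Qed.

Definition tpair (S : pDynSys) (g : pgrp S) (x : psp S)
  (gx : x \in pdom g^-1) : tdom S :=
  elt (mem_set (set_mem gx : tdom S (g : discrete_topology (pgrp S), x))).

Definition trng (S : pDynSys) (p : tdom S) : psp S := papp (tdomP p).

Record orbitMorphism (S T : pDynSys) := OrbitMorphism {
  om_phi : psp S -> psp T;
  om_a : tdom S -> pgrp T;
  om_phi_cont : continuous om_phi;
  om_a_cont : continuous (om_a : tdom S -> discrete_topology (pgrp T));
  om_dom : forall g x (gx : x \in pdom g^-1),
    om_phi x \in pdom (om_a (tpair gx))^-1;
  om_act : forall g x (gx : x \in pdom g^-1),
    om_phi (papp gx) = papp (om_dom gx);
  om_aM : forall g1 g2 x (x2 : x \in pdom g2^-1) (x12 : x \in pdom (g1 * g2)^-1)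
    (g2x1 : papp x2 \in pdom g1^-1),
    om_a (tpair x12) = om_a (tpair g2x1) * om_a (tpair x2)
}.

Section PartialActionTheory.
Variable S : pDynSys.
Implicit Types (g : pgrp S) (x : psp S) (p q : tdom S).

Lemma papp_eq g g' x x' (gx : x \in pdom g^-1) (gx' : x' \in pdom g'^-1) :
  g = g' -> x = x' -> papp gx = papp gx'.
Proof.
by move=> eg ex; subst g' x'; congr papp; exact: bool_irrelevance.
Qed.

Lemma tdom_eq p q : tgrp p = tgrp q -> tsrc p = tsrc q -> p = q.
Proof.
move=> eg ex; apply: val_inj; rewrite [LHS]surjective_pairing.
by rewrite [RHS]surjective_pairing; congr pair.
Qed.

Lemma tpairK p : tpair (tdomP p) = p.
Proof. exact: tdom_eq. Qed.

Lemma trng_tpair g x (gx : x \in pdom g^-1) : trng (tpair gx) = papp gx.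
Proof. exact: papp_eq. Qed.

Lemma papp_dom g x (gx : x \in pdom g^-1) : papp gx \in pdom g.
Proof. exact: valP. Qed.

Lemma dom1 x : x \in pdom (1 : pgrp S)^-1.
Proof. by rewrite invg1 pdom1 in_setT. Qed.

Lemma papp1 x (h : x \in pdom (1 : pgrp S)^-1) : papp h = x.
Proof. exact: pact1. Qed.

Lemma domM g1 g2 x (x2 : x \in pdom g2^-1) (h : papp x2 \in pdom g1^-1) :
  x \in pdom (g1 * g2)^-1.
Proof.
have: (pdom g2 `&` pdom g1^-1) (papp x2).
  by split; apply: set_mem => //; exact: papp_dom.
rewrite -pact_img => -[y /= Hy ey].
have [_ [f' [/can_inj inj _ _]]] := pact_homeo g2.
suff yx : y = elt x2 by apply/mem_set; rewrite yx in Hy.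
exact/inj/val_inj.
Qed.

Lemma pappM g1 g2 x (x2 : x \in pdom g2^-1) (h : papp x2 \in pdom g1^-1)
  (x12 : x \in pdom (g1 * g2)^-1) : papp x12 = papp h.
Proof. exact: pactM. Qed.

Lemma domV g x (gx : x \in pdom g^-1) : papp gx \in pdom (g^-1)^-1.
Proof. by rewrite invgK papp_dom. Qed.

Lemma pappV g x (gx : x \in pdom g^-1) (h : papp gx \in pdom (g^-1)^-1) :
  papp h = x.
Proof.
have x12 := domM h.
rewrite -(pappM h x12) -[RHS](papp1 (dom1 x)).
by apply: papp_eq; rewrite ?mulVg.
Qed.

Lemma tsrc_cont : continuous (@tsrc S).
Proof.
move=> p; apply: (@continuous_comp _ _ _ (val : tdom S -> _) snd).
  exact: initial_continuous.
exact: cvg_snd.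
Qed.

Lemma tgrp_cont : continuous (@tgrp S : _ -> discrete_topology (pgrp S)).
Proof.
move=> p; apply: (@continuous_comp _ _ _ (val : tdom S -> _) fst).
  exact: initial_continuous.
exact: cvg_fst.
Qed.

End PartialActionTheory.

Lemma subtype_continuous (X Y : topologicalType) (A : set Y) (f : X -> A) :
  continuous (val \o f) -> continuous f.
Proof.
move=> /continuousP cf; apply/continuousP => B [C oC <-].
exact: (cf C oC).
Qed.

Lemma tdom_continuousP (S : pDynSys) (Y : topologicalType) (f : tdom S -> Y) :
  (forall g, continuous
     (fun x : pdom (g : pgrp S)^-1 => f (tpair (valP x)))) -> continuous f.
Proof.
move=> cf p A Af.
pose x0 : pdom (tgrp p)^-1 := elt (tdomP p).
have ex0 : tpair (valP x0) = p by exact: tdom_eq.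
have : nbhs x0 [set x | A (f (tpair (valP x)))].
  by have := cf (tgrp p) x0 A; rewrite ex0 => /(_ Af).
rewrite nbhsE => -[B [[C oC CB] Bx0] BA].
have Cp : nbhs (tsrc p) C.
  by apply: open_nbhs_nbhs; split => //; rewrite -CB in Bx0.
have N1 : nbhs p [set q | C (tsrc q)] := tsrc_cont Cp.
have N2 : nbhs p [set q | tgrp q = tgrp p].
  exact: (tgrp_cont (@discrete_set1 (discrete_topology (pgrp S)) _)).
change (nbhs p (f @^-1` A)).
apply: filterS2 N1 N2 => q /= Cq eg.
have qd : tsrc q \in pdom (tgrp p)^-1 by rewrite -eg tdomP.
have : A (f (tpair (valP (elt qd : pdom (tgrp p)^-1)))).
  by apply: BA; rewrite -CB.
by congr (A (f _)); exact: tdom_eq.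
Qed.

Lemma pair_continuous (X Y Z : topologicalType) (f : X -> Y) (g : X -> Z) :
  continuous f -> continuous g -> continuous (fun x => (f x, g x)).
Proof. by move=> cf cg x; apply: cvg_pair; [exact: cf|exact: cg]. Qed.

Section TransformationGroupoid.
Variable S : pDynSys.
Implicit Types p q : tdom S.

Definition tunit (x : psp S) : tdom S := tpair (dom1 x).

Definition tinv p : tdom S := tpair (domV (tdomP p)).

Lemma tmul_dom p q (e : tsrc p = trng q) :
  tsrc q \in pdom (tgrp p * tgrp q)^-1.
Proof. by apply: (domM (x2 := tdomP q)); rewrite -[papp _]e tdomP. Qed.

Definition tmul p q (e : tsrc p = trng q) : tdom S := tpair (tmul_dom e).

Lemma trng_mul p q (e : tsrc p = trng q) : trng (tmul e) = trng p.
Proof.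
rewrite trng_tpair.
have h : papp (tdomP q) \in pdom (tgrp p)^-1 by rewrite -[papp _]e tdomP.
by rewrite (pappM h); exact: papp_eq.
Qed.

Lemma tinv_rng p : trng (tinv p) = tsrc p.
Proof. by rewrite trng_tpair pappV. Qed.

Lemma trng_cont : continuous (@trng S).
Proof.
apply: tdom_continuousP => g.
have -> : (fun x : pdom g^-1 => trng (tpair (valP x))) = val \o @pact S g.
  by apply: funext => x; rewrite trng_tpair /papp /=; congr (val (pact _));
     exact: val_inj.
move=> x; apply: continuous_comp; last exact: initial_continuous.
by have [+ _] := pact_homeo g; apply.
Qed.

Lemma tunit_cont : continuous tunit.
Proof.
apply: subtype_continuous.
apply: (@pair_continuous _ (discrete_topology (pgrp S)) _ (cst 1) idfun).
  by move=> x; exact: cvg_cst.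
by move=> x; exact: cvg_id.
Qed.

Lemma tinv_cont : continuous tinv.
Proof.
apply: subtype_continuous.
apply: (@pair_continuous _ (discrete_topology (pgrp S)) _
  (fun p => (tgrp p)^-1) (@trng S)); last exact: trng_cont.
move=> p; apply: (@continuous_comp _ (discrete_topology (pgrp S)) _
  (@tgrp S) (fun g => g^-1 : discrete_topology (pgrp S))).
  exact: tgrp_cont.
move=> A /nbhs_singleton gA.
by rewrite nbhs_simpl /= nbhs_principalE; apply/principal_filterP.
Qed.

Lemma tmul_cont : continuous
  (fun p : [set p : tdom S * tdom S | tsrc p.1 = trng p.2] =>
     tmul (set_mem (valP p))).
Proof.
set C := [set p : tdom S * tdom S | _].
pose D := discrete_topology (pgrp S).
have c1 : continuous (fun p : C => (val p).1).
  by move=> p; apply: (@continuous_comp _ _ _ (val : C -> _) fst);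
    [exact: initial_continuous|exact: cvg_fst].
have c2 : continuous (fun p : C => (val p).2).
  by move=> p; apply: (@continuous_comp _ _ _ (val : C -> _) snd);
    [exact: initial_continuous|exact: cvg_snd].
apply: subtype_continuous.
apply: (@pair_continuous _ D _ (fun p : C => tgrp (val p).1 * tgrp (val p).2)
  (fun p : C => tsrc (val p).2)); last first.
  move=> p; apply: (@continuous_comp _ _ _ (fun p : C => (val p).2) (@tsrc S)).
    exact: c2.
  exact: tsrc_cont.
move=> p A /(nbhs_singleton) Ap.
have N1 : nbhs p [set q : C | tgrp (val q).1 = tgrp (val p).1].
  exact: (c1 p _ (tgrp_cont (@discrete_set1 D _))).
have N2 : nbhs p [set q : C | tgrp (val q).2 = tgrp (val p).2].
  exact: (c2 p _ (tgrp_cont (@discrete_set1 D _))).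
change (nbhs p ((fun p : C => tgrp (val p).1 * tgrp (val p).2) @^-1` A)).
by apply: filterS2 N1 N2 => q /= -> ->.
Qed.

Lemma tunit_rng x : trng (tunit x) = x.
Proof. by rewrite trng_tpair papp1. Qed.

Lemma tmulA p q r (pq : tsrc p = trng q) (qr : tsrc q = trng r)
  (p_qr : tsrc p = trng (tmul qr)) (pq_r : tsrc (tmul pq) = trng r) :
  tmul p_qr = tmul pq_r.
Proof. by apply: tdom_eq => //; exact: mulgA. Qed.

Lemma tmul_unitl p (e : tsrc (tunit (trng p)) = trng p) : tmul e = p.
Proof. by apply: tdom_eq => //; exact: mul1g. Qed.

Lemma tmul_unitr p (e : tsrc p = trng (tunit (tsrc p))) : tmul e = p.
Proof. by apply: tdom_eq; [exact: mulg1|]. Qed.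

Lemma tmulV p (e : tsrc p = trng (tinv p)) : tmul e = tunit (trng p).
Proof. by apply: tdom_eq; [exact: mulgV|]. Qed.

Lemma tmulVl p (e : tsrc (tinv p) = trng p) : tmul e = tunit (tsrc p).
Proof. by apply: tdom_eq => //; exact: mulVg. Qed.

Definition transformation_groupoid : topGroupoid := {|
  gunits := psp S;
  garr := tdom S;
  gsrc := @tsrc S;
  grng := @trng S;
  gunit := tunit;
  ginv := tinv;
  gmul := tmul;
  gsrc_unit := fun _ => erefl;
  grng_unit := tunit_rng;
  gsrc_mul := fun _ _ _ => erefl;
  grng_mul := trng_mul;
  gsrc_inv := fun _ => erefl;
  grng_inv := tinv_rng;
  gmulA := tmulA;
  gmul_unitl := tmul_unitl;
  gmul_unitr := tmul_unitr;
  gmulV := tmulV;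
  gmulVl := tmulVl;
  gsrc_cont := @tsrc_cont S;
  grng_cont := trng_cont;
  gunit_cont := tunit_cont;
  ginv_cont := tinv_cont;
  gmul_cont := tmul_cont
|}.

End TransformationGroupoid.

Lemma orbitMorphism_eq (S T : pDynSys) (f f' : orbitMorphism S T) :
  om_phi f = om_phi f' -> om_a f = om_a f' -> f = f'.
Proof.
case: f f' => [u a c1 c2 d e m] [u' a' c1' c2' d' e' m'] /= uu' aa'.
subst u' a'.
have dd' : d = d' by exact: Prop_irrelevance.
subst d'; rewrite (Prop_irrelevance c1 c1') (Prop_irrelevance c2 c2').
by rewrite (Prop_irrelevance e e') (Prop_irrelevance m m').
Qed.

Definition orbitMorphism_id (S : pDynSys) : orbitMorphism S S := {|
  om_phi := idfun;
  om_a := @tgrp S;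
  om_phi_cont := @idfun_cont (psp S);
  om_a_cont := @tgrp_cont S;
  om_dom := fun g x gx => gx;
  om_act := fun g x gx => erefl;
  om_aM := fun g1 g2 x x2 x12 g2x1 => erefl
|}.

Section Composition.
Variables S T K : pDynSys.

Lemma om_domP (f : orbitMorphism S T) (p : tdom S) :
  om_phi f (tsrc p) \in pdom (om_a f p)^-1.
Proof. by have := om_dom f (tdomP p); rewrite tpairK. Qed.

Lemma om_pair_cont (f : orbitMorphism S T) :
  continuous (fun p : tdom S => tpair (om_domP f p)).
Proof.
apply: subtype_continuous.
apply: (@pair_continuous _ (discrete_topology (pgrp T)) _ (om_a f)
  (om_phi f \o @tsrc S)); first exact: om_a_cont.
by move=> p; apply: continuous_comp; [exact: tsrc_cont|exact: om_phi_cont].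
Qed.

Variables (f : orbitMorphism T K) (f' : orbitMorphism S T).

Definition om_comp_a (p : tdom S) : pgrp K := om_a f (tpair (om_domP f' p)).

Lemma om_comp_aE (g : pgrp S) x (gx : x \in pdom g^-1) :
  om_comp_a (tpair gx) = om_a f (tpair (om_dom f' gx)).
Proof. by congr om_a; exact: tdom_eq. Qed.

Lemma om_comp_phi_cont : continuous (om_phi f \o om_phi f').
Proof. by move=> x; apply: continuous_comp; exact: om_phi_cont. Qed.

Lemma om_comp_a_cont :
  continuous (om_comp_a : tdom S -> discrete_topology (pgrp K)).
Proof.
move=> p; apply: (@continuous_comp _ _ _ (fun p => tpair (om_domP f' p))
  (om_a f : _ -> discrete_topology (pgrp K))).
  exact: om_pair_cont.
exact: om_a_cont.
Qed.

Lemma om_comp_dom (g : pgrp S) x (gx : x \in pdom g^-1) :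
  (om_phi f \o om_phi f') x \in pdom (om_comp_a (tpair gx))^-1.
Proof. by rewrite om_comp_aE; exact: om_dom. Qed.

Lemma om_comp_act (g : pgrp S) x (gx : x \in pdom g^-1) :
  (om_phi f \o om_phi f') (papp gx) = papp (om_comp_dom gx).
Proof.
by rewrite /= om_act om_act; apply: papp_eq => //; rewrite om_comp_aE.
Qed.

Lemma om_comp_aM (g1 g2 : pgrp S) x (x2 : x \in pdom g2^-1)
  (x12 : x \in pdom (g1 * g2)^-1) (g2x1 : papp x2 \in pdom g1^-1) :
  om_comp_a (tpair x12) = om_comp_a (tpair g2x1) * om_comp_a (tpair x2).
Proof.
rewrite !om_comp_aE.
have h : papp (om_dom f' x2) \in pdom (om_a f' (tpair g2x1))^-1.
  by rewrite -om_act om_dom.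
have h12 :
    om_phi f' x \in pdom (om_a f' (tpair g2x1) * om_a f' (tpair x2))^-1.
  by rewrite -(om_aM f' x12 g2x1) om_dom.
have -> : tpair (om_dom f' x12) = tpair h12.
  by apply: tdom_eq => //; exact: om_aM.
rewrite (om_aM f h12 h); congr (om_a f _ * _).
by apply: tdom_eq => //=; rewrite /tsrc /= om_act.
Qed.

Definition orbitMorphism_comp : orbitMorphism S K := {|
  om_phi := om_phi f \o om_phi f';
  om_a := om_comp_a;
  om_phi_cont := om_comp_phi_cont;
  om_a_cont := om_comp_a_cont;
  om_dom := om_comp_dom;
  om_act := om_comp_act;
  om_aM := om_comp_aM
|}.

End Composition.

Lemma orbitMorphism_idl (S T : pDynSys) (f : orbitMorphism S T) :
  orbitMorphism_comp (orbitMorphism_id T) f = f.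
Proof. exact: orbitMorphism_eq. Qed.

Lemma orbitMorphism_idr (S T : pDynSys) (f : orbitMorphism S T) :
  orbitMorphism_comp f (orbitMorphism_id S) = f.
Proof.
apply: orbitMorphism_eq => //.
by apply: funext => p; apply: (congr1 (om_a f)); exact: tdom_eq.
Qed.

Lemma orbitMorphismA (S T K L : pDynSys) (f : orbitMorphism K L)
  (g : orbitMorphism T K) (h : orbitMorphism S T) :
  orbitMorphism_comp f (orbitMorphism_comp g h) =
  orbitMorphism_comp (orbitMorphism_comp f g) h.
Proof.
apply: orbitMorphism_eq => //.
by apply: funext => p; apply: (congr1 (om_a f)); exact: tdom_eq.
Qed.

Definition PDynSys_Orb : category := {|
  obj := pDynSys;
  hom := orbitMorphism;
  cat_id := orbitMorphism_id;
  cat_comp := orbitMorphism_comp;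
  cat_idl := orbitMorphism_idl;
  cat_idr := orbitMorphism_idr;
  cat_compA := orbitMorphismA
|}.

(* Main.v *)
Require Import Defs.
From mathcomp Require Import all_boot all_classical.
From mathcomp Require Import topology.

(** An arrow of the transformation groupoid of [S] is a pair (g, x) with g.x
    defined, and a continuous map into the arrow space of the transformation
    groupoid of [T] is a pair of continuous maps into the discrete group and
    into the space. A groupoid homomorphism commutes with the source maps, so
    on arrows it must have the form (g, x) |-> (a(g, x), phi x), where phi is
    its effect on units and a is its group coordinate. Under this
    correspondence the axioms of orbit morphisms and of homomorphisms match:
    compatibility with sources says that phi x lies in the domain of a(g, x);
    compatibility with ranges is the equivariance phi(g.x) = a(g, x).phi(x);
    multiplicativity is the cocycle identity, since two arrows (g1, y) and
    (g2, x) are composable exactly when y = g2.x. Preservation of units then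
    comes for free, because the cocycle identity makes a(1, x) idempotent and
    the only idempotent of a group is its identity.

    Hence [theta] sends orbit morphisms to homomorphisms, and
    [orbit_of_hom] recovers from a homomorphism the orbit morphism that it
    comes from ([orbit_of_homK]). The pair (phi, a) can be read off from its
    image ([theta_inj]). *)

Set Implicit Arguments.
Unset Strict Implicit.
Unset Printing Implicit Defensive.

Local Open Scope group_scope.

Section OrbitMorphismToHom.
Variables (S T : pDynSys) (m : orbitMorphism S T).

Definition theta_arr (p : tdom S) : tdom T := tpair (om_domP m p).

Lemma theta_rng (p : tdom S) : trng (theta_arr p) = om_phi m (trng p).
Proof. by rewrite trng_tpair om_act; apply: papp_eq => //; rewrite tpairK. Qed.

(** The unit arrow at x is idempotent, hence so is its value under the cocycle,
    and in a group this forces the identity. *)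
Lemma om_a1 (x : psp S) : om_a m (tunit x) = 1.
Proof.
have h : papp (dom1 x) \in pdom (1 : pgrp S)^-1 by exact: dom1.
have h11 : x \in pdom (1 * 1 : pgrp S)^-1 by rewrite mulg1 dom1.
have := om_aM m h11 h.
have -> : tpair h11 = tunit x by apply: tdom_eq => //; exact: mulg1.
have -> : tpair h = tunit x by apply: tdom_eq => //; exact: papp1.
by move=> /esym/(canRL (mulgK _)); rewrite mulgV.
Qed.

Lemma om_a_mul (p q : tdom S) (e : tsrc p = trng q) :
  om_a m (tmul e) = om_a m p * om_a m q.
Proof.
have h : papp (tdomP q) \in pdom (tgrp p)^-1 by rewrite -[papp _]e tdomP.
rewrite (om_aM m (tmul_dom e) h) tpairK; congr (om_a m _ * _).
by apply: tdom_eq.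
Qed.

Lemma theta_unit (x : psp S) : theta_arr (tunit x) = tunit (om_phi m x).
Proof. by apply: tdom_eq => //; exact: om_a1. Qed.

Lemma theta_mul (p q : tdom S) (e : tsrc p = trng q)
    (e' : tsrc (theta_arr p) = trng (theta_arr q)) :
  theta_arr (tmul e) = tmul e'.
Proof. by apply: tdom_eq => //; exact: om_a_mul. Qed.

Definition theta :
    grpdHom (transformation_groupoid S) (transformation_groupoid T) :=
  @GrpdHom (transformation_groupoid S) (transformation_groupoid T)
    (om_phi m) theta_arr (@om_phi_cont _ _ m) (@om_pair_cont _ _ m)
    (fun=> erefl) theta_rng theta_unit theta_mul.

End OrbitMorphismToHom.

Section HomToOrbitMorphism.
Variables S T : pDynSys.
Variable f : grpdHom (transformation_groupoid S) (transformation_groupoid T).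

Definition hom_cocycle (p : tdom S) : pgrp T := tgrp (f p : tdom T).

Lemma hom_cocycle_cont :
  continuous (hom_cocycle : tdom S -> discrete_topology (pgrp T)).
Proof.
move=> p; apply: (@continuous_comp _ _ _ (harr f)
  (@tgrp T : _ -> discrete_topology (pgrp T))).
  exact: harr_cont.
exact: tgrp_cont.
Qed.

Lemma hom_src (p : tdom S) : tsrc (f p : tdom T) = hunits f (tsrc p).
Proof. exact: (hsrc f). Qed.

Lemma hom_dom (g : pgrp S) x (gx : x \in pdom g^-1) :
  hunits f x \in pdom (hom_cocycle (tpair gx))^-1.
Proof. by have := tdomP (f (tpair gx) : tdom T); rewrite hom_src. Qed.

Lemma hom_act (g : pgrp S) x (gx : x \in pdom g^-1) :
  hunits f (papp gx) = papp (hom_dom gx).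
Proof.
rewrite -trng_tpair -[LHS](hrng f (tpair gx)).
by apply: papp_eq => //; exact: hom_src.
Qed.

(** (g1 g2, x) is the groupoid product of (g1, g2.x) and (g2, x), and the
    group coordinate of a product is the product of the group coordinates. *)
Lemma hom_cocycleM (g1 g2 : pgrp S) x (x2 : x \in pdom g2^-1)
    (x12 : x \in pdom (g1 * g2)^-1) (g2x1 : papp x2 \in pdom g1^-1) :
  hom_cocycle (tpair x12)
    = hom_cocycle (tpair g2x1) * hom_cocycle (tpair x2).
Proof.
have e : tsrc (tpair g2x1) = trng (tpair x2) by rewrite trng_tpair.
have e' : tsrc (f (tpair g2x1) : tdom T) = trng (f (tpair x2) : tdom T).
  by rewrite hom_src e; exact/esym/(hrng f).
have -> : tpair x12 = tmul e by apply: tdom_eq.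
have fM : f (tmul e) = tmul e' by exact: (@hmul _ _ f _ _ e e').
by rewrite /hom_cocycle fM.
Qed.

Definition orbit_of_hom : orbitMorphism S T := {|
  om_phi := hunits f;
  om_a := hom_cocycle;
  om_phi_cont := @hunits_cont _ _ f;
  om_a_cont := hom_cocycle_cont;
  om_dom := hom_dom;
  om_act := hom_act;
  om_aM := hom_cocycleM
|}.

Lemma orbit_of_homK : theta orbit_of_hom = f.
Proof.
apply: grpdHom_eq => //; apply: funext => p.
by apply: tdom_eq => //; rewrite hom_src.
Qed.

End HomToOrbitMorphism.

Lemma theta_inj (S T : pDynSys) : injective (@theta S T).
Proof.
move=> m m' e; apply: orbitMorphism_eq; first exact: (congr1 (@hunits _ _) e).
have ea : theta_arr m = theta_arr m' by exact: (congr1 (@harr _ _) e).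
apply: funext => p; have ep : theta_arr m p = theta_arr m' p by rewrite ea.
exact: (congr1 (@tgrp T) ep).
Qed.

Lemma theta_functor :
  @functor_laws PDynSys_Orb TopGrpd transformation_groupoid theta.
Proof.
split=> [S|S T K f' f]; apply: grpdHom_eq => //; apply: funext => p;
  exact: tdom_eq.
Qed.

Theorem theorem3p8 :
  exists (Theta : forall S T : PDynSys_Orb, hom S T ->
            @hom TopGrpd (transformation_groupoid S) (transformation_groupoid T))
         (ThetaP : @functor_laws PDynSys_Orb TopGrpd transformation_groupoid Theta),
    let F : functor PDynSys_Orb TopGrpd := Functor ThetaP in
    fully_faithful F /\
    forall (S T : pDynSys) (m : orbitMorphism S T)
           (g : pgrp S) (x : psp S) (gx : x \in pdom g^-1%g),
      val (harr (functor_map F m) (tpair gx)) = (om_a m (tpair gx), om_phi m x).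
Proof.
exists theta, theta_functor => F; split=> //; split=> [S T f|S T].
  by exists (orbit_of_hom f); exact: orbit_of_homK.
exact: theta_inj.
Qed.
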